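(* Consider the asynchronous best response dynamics $Z(t)$ described in the context, with an arbitrary (possibly random) initial configuration $Z(0)\in[0,1]^n$. Then, with probability one, $Z(t)$ converges to the set $$\mathcal Z^*=\{\mathbf{1}-\alpha[\pi]\sigma^2:\ 0<\alpha\le\alpha_*\},\qquad\alpha_*=\frac1{\max_i\pi_i\sigma_i^2},$$ i.e. the distance from $Z(t)$ to $\mathcal Z^*$ tends to $0$ as $t\to\infty$.
   Context: Let $n\ge1$ and $\mathcal V=\{1,\dots,n\}$. Let $P\in\mathbb{R}^{n\times n}$ be a row-stochastic, irreducible, aperiodic matrix (the graph on $\mathcal V$ with edge $(i,j)$ iff $P_{ij}>0$ is strongly connected and has gcd of cycle lengths $1$), and $\pi$ the unique probability vector with $P'\pi=\pi$. For $z\in[0,1]^n$ let $W(z)=(I-[z])P+[z]$ ($[z]$ the diagonal matrix with diagonal $z$); the limit $H(z)=\lim_{t\to\infty}W(z)^t$ exists and is row-stochastic. Let $\sigma_1^2,\dots,\sigma_n^2>0$, $\sigma^2=(\sigma_1^2,\dots,\sigma_n^2)'$. Agent $i$'s cost is $\upsilon_i(z)=\sum_jH_{ij}(z)^2\sigma_j^2$, and her best response set to $z_{-i}=(z_j)_{j\ne i}$ is $\mathcal B_i(z_{-i})=\arg\min_{z_i\in[0,1]}\upsilon_i(z_i,z_{-i})$ (it is always nonempty and is either a singleton or an interval). The asynchronous best response dynamics is the discrete-time Markov chain $Z(t)$ on $[0,1]^n$ in which, at each time $t=0,1,2,\dots$, an agent $k$ is chosen uniformly at random from $\mathcal V$ (independently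 over time), $Z_k(t+1)$ is drawn uniformly at random from $\mathcal B_k(Z_{-k}(t))$, and $Z_{-k}(t+1)=Z_{-k}(t)$. *)

(* Defs.v *)
From HB Require Import structures.
From mathcomp Require Import all_boot all_order all_algebra.
From mathcomp Require Import all_classical all_reals all_analysis.
Set Implicit Arguments. Unset Strict Implicit. Unset Printing Implicit Defensive.
Import Order.TTheory GRing.Theory Num.Theory numFieldNormedType.Exports.
Local Open Scope classical_set_scope.
Local Open Scope ring_scope.

Section Model.
Variables (R : realType) (n : nat).

Definition row_stochastic (P : 'M[R]_n) : Prop :=
  (forall i j, 0 <= P i j) /\ (forall i, \sum_j P i j = 1).

Definition pgraph (P : 'M[R]_n) : rel 'I_n := fun i j => 0 < P i j.

Definition strongly_connected (P : 'M[R]_n) : Prop :=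
  forall i j, connect (pgraph P) i j.

Definition cycle_length (P : 'M[R]_n) (k : nat) : Prop :=
  exists (i : 'I_n) (s : seq 'I_n),
    [/\ size s = k, (0 < k)%N, path (pgraph P) i s & last i s = i].

Definition aperiodic (P : 'M[R]_n) : Prop :=
  forall d : nat, (forall k, cycle_length P k -> (d %| k)%N) -> d = 1%N.

Definition stationary_prob (P : 'M[R]_n) (pi : 'rV[R]_n) : Prop :=
  (forall i, 0 <= pi 0 i) /\ \sum_i pi 0 i = 1 /\ pi *m P = pi.

Definition Wmx (P : 'M[R]_n) (z : 'rV[R]_n) : 'M[R]_n :=
  (1%:M - diag_mx z) *m P + diag_mx z.

Definition mxpow (A : 'M[R]_n) (t : nat) : 'M[R]_n := iter t (mulmx A) 1%:M.

Definition Hmx (P : 'M[R]_n) (z : 'rV[R]_n) : 'M[R]_n :=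
  \matrix_(i, j) limn (fun t : nat => mxpow (Wmx P z) t i j).

Definition cost (P : 'M[R]_n) (s2 : 'rV[R]_n) (i : 'I_n) (z : 'rV[R]_n) : R :=
  \sum_j (Hmx P z i j) ^+ 2 * s2 0 j.

Definition setc (z : 'rV[R]_n) (i : 'I_n) (x : R) : 'rV[R]_n :=
  \row_j (if j == i then x else z 0 j).

Definition best_resp (P : 'M[R]_n) (s2 : 'rV[R]_n) (i : 'I_n) (z : 'rV[R]_n)
  : set R :=
  [set x | 0 <= x <= 1 /\
     forall y, 0 <= y <= 1 -> cost P s2 i (setc z i x) <= cost P s2 i (setc z i y)].

(* one step of the asynchronous dynamics: agent k revises and draws her new
   value uniformly from the best-response set (a singleton or an interval);
   the uniform draw is realised as inf B + u (sup B - inf B) with u ~ U[0,1] *)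
Definition br_step (P : 'M[R]_n) (s2 : 'rV[R]_n) (z : 'rV[R]_n) (k : 'I_n) (u : R)
  : 'rV[R]_n :=
  let B := best_resp P s2 k z in
  setc z k (inf B + u * (sup B - inf B)).

Fixpoint traj (P : 'M[R]_n) (s2 : 'rV[R]_n) (z0 : 'rV[R]_n)
  (K : nat -> 'I_n) (U : nat -> R) (t : nat) : 'rV[R]_n :=
  match t with
  | 0%N => z0
  | t'.+1 => br_step P s2 (traj P s2 z0 K U t') (K t') (U t')
  end.

Definition alpha_star (pi s2 : 'rV[R]_n) : R :=
  1 / \big[Num.max/0]_i (pi 0 i * s2 0 i).

Definition Zstar (pi s2 : 'rV[R]_n) : set 'rV[R]_n :=
  [set z | exists alpha : R, 0 < alpha <= alpha_star pi s2 /\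
       z = \row_i (1 - alpha * pi 0 i * s2 0 i)].

Definition edist (z w : 'rV[R]_n) : R := Num.sqrt (\sum_i (z 0 i - w 0 i) ^+ 2).
Definition dist_set (z : 'rV[R]_n) (A : set 'rV[R]_n) : R :=
  inf [set edist z w | w in A].

End Model.

Section Noise.
Local Open Scope ereal_scope.
(* The initial configuration Z0 (coordinates Z0 i), the chosen agents K t and
   the uniform variates U t on a probability space: Z0 is independent of the
   i.i.d. sequence (K t, U t)_t, with K t uniform on V and U t uniform on [0,1]
   independent of each other (product rule on all finite cylinder rectangles). *)
Definition driving_noise (d : measure_display) (T : measurableType d) (R : realType)
  (P : probability T R) (n : nat) (Z0 : 'I_n -> T -> R)
  (K : nat -> T -> 'I_n) (U : nat -> T -> R) : Prop :=
  [/\ (forall i, measurable_fun setT (Z0 i)),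
      (forall t k, measurable (K t @^-1` [set k])),
      (forall t, measurable_fun setT (U t)) &
      forall (s : seq nat) (B : 'I_n -> set R) (A : nat -> {set 'I_n})
             (C : nat -> set R),
        uniq s -> (forall i, measurable (B i)) -> (forall t, measurable (C t)) ->
        fine (P (\bigcap_(i in [set: 'I_n]) (Z0 i @^-1` B i) `&`
                 \bigcap_(t in [set t | t \in s])
                    (K t @^-1` [set k | k \in A t] `&` U t @^-1` C t))) =
        (fine (P (\bigcap_(i in [set: 'I_n]) (Z0 i @^-1` B i))) *
         \prod_(t <- s) (#|A t|%:R / n%:R *
                         fine (lebesgue_measure (C t `&` `[0, 1]%classic))))%R].
End Noise.

(* Main.v *)
(** Write [m_i = pi_i s_i] ([s_i] the variance) and [y_i = m_i / (1 - z_i)], so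
    that [Zstar] is the set of configurations with all [y_i] equal to a common
    [c >= max m].  When nobody is stubborn ([z < 1]), [H(z)] has identical rows
    proportional to [pi_j / (1 - z_j)], and agent [i]'s unique best response is
    [y_i := max m_i G], where [G] is the average of the other [y_j] weighted by
    [y_j / s_j].  Hence the range of [y] shrinks, and one sweep through all
    agents contracts it by a fixed factor.  When somebody is stubborn
    ([z_k = 1]), agent [i] is indifferent among all [x < 1]; revising once in
    order of decreasing variance makes everybody non-stubborn.  So the same
    fixed word of agents, which almost surely occurs infinitely often, handles
    both phases, and the rest of the argument is deterministic. *)

Require Import Defs.
From HB Require Import structures.
From mathcomp Require Import all_boot all_order all_algebra.
From mathcomp Require Import all_classical all_reals all_analysis.
From mathcomp Require Import ring lra.
Import Order.TTheory GRing.Theory Num.Theory numFieldNormedType.Exports.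
Local Open Scope classical_set_scope.
Local Open Scope ring_scope.
Set Implicit Arguments. Unset Strict Implicit. Unset Printing Implicit Defensive.

(** * Powers of stochastic matrices *)

(** Let [g] be the least positive difference of two elements [a], [a + g] of [S]. A nonzero
    remainder [r %% g] with [r] in [S] would be a smaller difference, so [g] divides all of [S] and
    [g = 1]; then [a] and [a.+1] generate every [t >= a * a]. *)
Lemma numerical_semigroup (S : nat -> Prop) :
  S 0%N -> (forall a b, S a -> S b -> S (a + b)%N) ->
  (forall d, (forall k, S k -> (d %| k)%N) -> d = 1%N) ->
  exists N, forall t, (N <= t)%N -> S t.
Proof.
move=> S0 SD gcdS.
have SM q a : S a -> S (q * a)%N.
  by move=> Sa; elim: q => [|q IH]; rewrite ?mul0n// mulSn; exact: SD.
pose D g := `[< (0 < g)%N /\ exists a, S a /\ S (a + g)%N >].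
have exD : exists g, D g.
  have [[k [Sk k0]]|nk] := pselect (exists k, S k /\ (0 < k)%N).
    by exists k; apply/asboolP; split => //; exists 0%N.
  (* If [S] were reduced to 0, then 2 would divide all its elements. *)
  have : 2%N = 1%N by apply: gcdS => k Sk; case: k Sk => // k Sk; case: nk; exists k.+1.
  by [].
have [g /asboolP [g0 [a [Sa Sag]]] gmin] := ex_minnP exD.
have g1 : g = 1%N.
  apply: gcdS => r Sr; rewrite /dvdn; apply/negPn/negP => r0.
  have /gmin : D (r %% g)%N.
    apply/asboolP; split; first by rewrite lt0n.
    exists (r %/ g * (a + g))%N; split; first exact: SM.
    have -> : (r %/ g * (a + g) + r %% g = r %/ g * a + r)%N.
      by rewrite {4}(divn_eq r g) mulnDr addnA.
    by apply: SD => //; exact: SM.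
  by rewrite leqNgt ltn_mod g0.
rewrite {}g1 addn1 in Sag.
exists (a * a)%N => t ht; have [a0|a0] := posnP a.
  by move: Sag; rewrite a0 => /(SM t); rewrite muln1.
have tm : (t %% a <= t %/ a)%N.
  by apply: (@leq_trans a); [rewrite ltnW// ltn_mod|rewrite leq_divRL].
have -> : t = ((t %/ a - t %% a) * a + t %% a * a.+1)%N.
  rewrite {1}(divn_eq t a) mulnBl mulnS addnCA subnK ?leq_mul2r ?tm ?orbT//.
  by rewrite addnC.
by apply: SD; apply: SM.
Qed.

Section MatrixPowers.
Variables (R : realType) (n : nat).
Implicit Types (A P : 'M[R]_n).

Lemma mxpowS A t : mxpow A t.+1 = A *m mxpow A t.
Proof. by []. Qed.

Lemma mxpowD A s t : mxpow A (s + t) = mxpow A s *m mxpow A t.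
Proof.
elim: s => [|s IH]; first by rewrite add0n mul1mx.
by rewrite addSn !mxpowS IH mulmxA.
Qed.

Lemma mxpow1 A : mxpow A 1 = A.
Proof. by rewrite mxpowS mulmx1. Qed.

Lemma mxpowSr A t : mxpow A t.+1 = mxpow A t *m A.
Proof. by rewrite -addn1 mxpowD mxpow1. Qed.

Lemma row_stochastic_mxpow A t : row_stochastic A -> row_stochastic (mxpow A t).
Proof.
move=> [A0 A1]; elim: t => [|t [IH0 IH1]].
  split => [i j|i]; first by rewrite mxE; case: (_ == _).
  rewrite (bigD1 i)//= mxE eqxx big1 ?addr0// => j /negPf ji.
  by rewrite mxE eq_sym ji.
split => [i j|i]; rewrite mxpowS.
  by rewrite mxE sumr_ge0// => k _; rewrite mulr_ge0.
under eq_bigr do rewrite mxE.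
rewrite exchange_big/= -[RHS](A1 i); apply: eq_bigr => k _.
by rewrite -mulr_sumr IH1 mulr1.
Qed.

Lemma mxpow_gt0_trans A s t i k j : row_stochastic A ->
  0 < mxpow A s i k -> 0 < mxpow A t k j -> 0 < mxpow A (s + t) i j.
Proof.
move=> sA h1 h2; rewrite mxpowD mxE (bigD1 k)//=.
rewrite ltr_pwDl ?mulr_gt0// sumr_ge0// => l _.
by rewrite mulr_ge0//; [case: (row_stochastic_mxpow s sA)|case: (row_stochastic_mxpow t sA)].
Qed.

Lemma mxpow_path_gt0 P i (s : seq 'I_n) : row_stochastic P ->
  path (pgraph P) i s -> 0 < mxpow P (size s) i (last i s).
Proof.
move=> sP; elim: s i => [|j s IH] i /=; first by rewrite mxE eqxx ltr01.
move=> /andP[ij /IH h]; apply: (@mxpow_gt0_trans P 1 (size s) i j _ sP _ h).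
by rewrite mxpow1.
Qed.

(** The return times to [i] form a numerical semigroup. Its gcd divides the length of every cycle,
    through whatever [j]: a closed walk from [i] via [j] can be taken with or without the cycle
    inserted at [j]. *)
Lemma mxpow_primitive P : row_stochastic P -> strongly_connected P ->
  aperiodic P -> exists N, forall i j, 0 < mxpow P N i j.
Proof.
move=> sP cP aP.
have walk i j : exists L, 0 < mxpow P L i j.
  have /connectP[s ps ->] := cP i j.
  by exists (size s); exact: mxpow_path_gt0.
have ret i : exists N, forall t, (N <= t)%N -> 0 < mxpow P t i i.
  apply: numerical_semigroup; first by rewrite mxE eqxx ltr01.
    by move=> a b; exact: mxpow_gt0_trans.
  move=> d dR; apply: aP => k [j [s [sk k0 ps ls]]].
  have hk : 0 < mxpow P k j j by rewrite -sk -{2}ls mxpow_path_gt0.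
  have [a ha] := walk i j; have [b hb] := walk j i.
  have dab := dR _ (mxpow_gt0_trans sP ha hb).
  have := dR _ (mxpow_gt0_trans sP (mxpow_gt0_trans sP ha hk) hb).
  by rewrite addnAC dvdn_addr.
have ev i j : exists N, forall t, (N <= t)%N -> 0 < mxpow P t i j.
  have [N hN] := ret i; have [L hL] := walk i j.
  exists (N + L)%N => t ht; rewrite -(@subnK L t); last exact: leq_trans (leq_addl _ _) ht.
  apply: mxpow_gt0_trans hL => //; apply: hN.
  by rewrite leq_subRL 1?addnC// (leq_trans (leq_addl _ _) ht).
have {}ev (ij : 'I_n * 'I_n) :
    exists N, forall t, (N <= t)%N -> 0 < mxpow P t ij.1 ij.2 by exact: ev.
have [f hf] := choice ev.
exists (\max_ij f ij) => i j; apply: (hf (i, j)).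
exact: (leq_bigmax_cond (i, j)).
Qed.

End MatrixPowers.

(** Monotonicity makes it enough to contract on infinitely many windows. If the limit [l] were
    positive, a late window would start below [(2 - q) * l] and end below [q * (2 - q) * l = (1 - (1
    - q) ^+ 2) * l < l]. *)
Lemma contracting_cvg0 (R : realType) (D : nat -> R) (q : R) (n : nat) :
  (forall t, 0 <= D t) -> (forall t, D t.+1 <= D t) -> 0 <= q -> q < 1 ->
  (forall t0, exists2 t, (t0 <= t)%N & D (t + n)%N <= q * D t) ->
  D @ \oo --> 0.
Proof.
move=> D0 Dd q0 q1 Dq.
have Dm : {homo D : s t / (s <= t)%N >-> t <= s} by apply/nonincreasing_seqP.
have Dc : cvgn D.
  by apply: nonincreasing_is_cvgn => //; exists 0 => _ [t _ <-].
have lD := nonincreasing_cvgn_ge Dm Dc.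
suff l0 : limn D = 0 by rewrite -l0.
apply/eqP; rewrite eq_le limr_ge ?andbT//; last by exists 0%N.
rewrite leNgt; apply/negP => lp.
have : limn D < limn D + (1 - q) * limn D by nra.
move=> /(cvgr_lt (limn D) Dc) [t0 _ ht0].
have [t tt0 ht] := Dq t0.
have h1 := ht0 t tt0; have h2 := le_trans (lD (t + n)%N) ht.
have h3 : 0 < (1 - q) * (1 - q) * limn D by rewrite !mulr_gt0 ?subr_gt0.
rewrite /= in h1; nra.
Qed.

Lemma cvg_sum_fin (R : realType) (I : finType) (Q : pred I) (f : I -> nat -> R)
    (l : I -> R) : (forall i, Q i -> f i @ \oo --> l i) ->
  (fun t => \sum_(i | Q i) f i t) @ \oo --> \sum_(i | Q i) l i.
Proof.
move=> fl; elim: (index_enum I) => [|i s IH].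
  by rewrite big_nil; under eq_fun do rewrite big_nil; exact: cvg_cst.
under eq_fun do rewrite big_cons; rewrite big_cons.
by case: ifPn => // Qi; apply: cvgD => //; exact: fl.
Qed.

(** * Oscillation of a vector and convergence of powers of a primitive matrix *)

Section Oscillation.
Variables (R : realType) (n : nat).
Implicit Types (A W : 'M[R]_n) (v : 'I_n -> R).

Definition osc v : R := \big[Num.max/0]_(ij : 'I_n * 'I_n) (v ij.1 - v ij.2).

Lemma osc_ge0 v : 0 <= osc v.
Proof. by rewrite /osc bigmax_idl le_max lexx. Qed.

Lemma osc_ge v i j : v i - v j <= osc v.
Proof. exact: (@le_bigmax _ _ _ _ (fun ij : 'I_n * 'I_n => v ij.1 - v ij.2) (i, j)). Qed.

Lemma osc_le v c : 0 <= c -> (forall i j, v i - v j <= c) -> osc v <= c.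
Proof. by move=> c0 vc; apply: bigmax_le => // -[i j] _; exact: vc. Qed.

(* Two independent copies of the chain meet at [k] with probability at least
   [e ^+ 2], and a meeting pair contributes nothing to the difference. *)
Lemma osc_stochastic A v (e : R) (k : 'I_n) : row_stochastic A ->
  0 <= e -> (forall i, e <= A i k) ->
  osc (fun i => \sum_l A i l * v l) <= (1 - e ^+ 2) * osc v.
Proof.
move=> [A0 A1] e0 eA.
have e1 : e <= 1.
  apply: le_trans (eA k) _; rewrite -(A1 k) (bigD1 k)//= lerDl.
  by rewrite sumr_ge0.
apply: osc_le => [|i j].
  by rewrite mulr_ge0 ?osc_ge0// subr_ge0 expr_le1.
have -> : \sum_l A i l * v l - \sum_l A j l * v l =
    \sum_l \sum_m A i l * A j m * (v l - v m).
  have -> : \sum_l \sum_m A i l * A j m * (v l - v m) =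
      \sum_l \sum_m (A i l * v l * A j m) - \sum_l \sum_m A i l * (A j m * v m).
    rewrite -sumrB; apply: eq_bigr => l _; rewrite -sumrB; apply: eq_bigr => m _.
    by ring.
  congr (_ - _).
    by apply: eq_bigr => l _; rewrite -mulr_sumr A1 mulr1.
  rewrite -[LHS]mul1r -(A1 i) mulr_suml; apply: eq_bigr => l _.
  by rewrite mulr_sumr.
rewrite pair_big/= (bigD1 (k, k))//= subrr mulr0 add0r.
apply: (@le_trans _ _ (\sum_(p | p != (k, k)) A i p.1 * A j p.2 * osc v)).
  by apply: ler_sum => -[l m] _ /=; rewrite ler_wpM2l ?osc_ge// mulr_ge0.
rewrite -mulr_suml ler_wpM2r ?osc_ge0//.
have -> : \sum_(p | p != (k, k)) A i p.1 * A j p.2 = 1 - A i k * A j k.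
  have : \sum_l \sum_m A i l * A j m = 1.
    by rewrite -[RHS](A1 i); apply: eq_bigr => l _; rewrite -mulr_sumr A1 mulr1.
  by rewrite pair_big/= (bigD1 (k, k))//= => <-; rewrite addrAC subrr add0r.
by rewrite lerD2l lerN2 expr2 ler_pM.
Qed.

Lemma osc_stochastic_le A v : row_stochastic A ->
  osc (fun i => \sum_l A i l * v l) <= osc v.
Proof.
move=> sA; have [k _|n0] := pickP (predT : pred 'I_n); last first.
  by apply: osc_le => [|i]; [exact: osc_ge0|have := n0 i].
apply: le_trans (@osc_stochastic A v 0 k sA _ _) _ => //; first by case: sA.
by rewrite expr0n subr0 mul1r.
Qed.

(** The oscillation of column [j] of [W ^ t] tends to 0, while its [h]-average stays equal to
    [h 0 j] by stationarity; so all entries of the column are squeezed towards [h 0 j]. *)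
Lemma mxpow_cvg_stationary W (N : nat) (h : 'rV[R]_n) : row_stochastic W ->
  (forall i j, 0 < mxpow W N i j) -> (forall i, 0 <= h 0 i) ->
  \sum_i h 0 i = 1 -> h *m W = h ->
  forall i j, (fun t => mxpow W t i j) @ \oo --> h 0 j.
Proof.
move=> sW WN h0 h1 hW i j.
pose D t := osc (fun i => mxpow W t i j).
have hWt t : h *m mxpow W t = h.
  by elim: t => [|t IH]; rewrite ?mulmx1// mxpowS mulmxA hW IH.
have DE s t : D (t + s)%N = osc (fun i => \sum_l mxpow W s i l * mxpow W t l j).
  by congr osc; apply/funext => k; rewrite addnC mxpowD mxE.
(* Any column of the positive matrix [W ^ N] can serve as the meeting state; [i] is at hand. *)
pose e := \big[Num.min/1]_k mxpow W N k i.
have e0 : 0 < e by apply: lt_bigmin.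
have eW k : e <= mxpow W N k i by apply: bigmin_le.
have e1 : e <= 1 by exact: bigmin_le_id.
have Dcvg : D @ \oo --> 0.
  apply: (@contracting_cvg0 _ _ (1 - e ^+ 2) N).
  - by move=> t; exact: osc_ge0.
  - by move=> t; rewrite -[t.+1]addn1 DE; apply: osc_stochastic_le; exact: row_stochastic_mxpow.
  - by rewrite subr_ge0 expr_le1 // ltW.
  - by rewrite ltrBlDr ltrDl exprn_gt0.
  - move=> t; exists t => //; rewrite DE.
    by apply: osc_stochastic eW => //; [exact: row_stochastic_mxpow|exact: ltW].
have hE t : h 0 j = \sum_k h 0 k * mxpow W t k j.
  by rewrite -{1}(hWt t) mxE.
apply/cvgrPdist_le => /= e' e'0.
have [T _ hT] := cvgr0_norm_le _ Dcvg e' e'0; exists T => // t /hT /= Dt.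
have De : D t <= e' by rewrite (le_trans (ler_norm _)).
have -> : mxpow W t i j = \sum_k h 0 k * mxpow W t i j.
  by rewrite -mulr_suml h1 mul1r.
rewrite (hE t) -sumrB (le_trans (ler_norm_sum _ _ _))//.
apply: (@le_trans _ _ (\sum_k h 0 k * e')); last by rewrite -mulr_suml h1 mul1r.
apply: ler_sum => k _; rewrite -mulrBr normrM ger0_norm// ler_wpM2l//.
by rewrite ler_norml lerNl opprB !(le_trans (osc_ge (fun i => mxpow W t i j) _ _)).
Qed.

End Oscillation.

(** * The limit matrix *)

Lemma seq_cvg_ge0 (R : realType) (f : nat -> R) (l : R) :
  (forall t, 0 <= f t) -> f @ \oo --> l -> 0 <= l.
Proof.
move=> f0 fl; rewrite -(cvg_lim (@Rhausdorff R) fl).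
by apply: limr_ge; [apply/cvg_ex; exists l|exists 0%N].
Qed.

Section LimitMatrix.
Variables (R : realType) (n : nat) (P : 'M[R]_n).
Hypotheses (sP : row_stochastic P) (cP : strongly_connected P).
Implicit Types (z : 'rV[R]_n) (g : 'I_n -> R).

(** A positive maximum would be attained outside [S], where harmonicity spreads it to all
    successors; strong connectivity then carries it to [k0], which lies in [S]. *)
Lemma maximum_principle (S : pred 'I_n) g (k0 : 'I_n) : S k0 ->
  (forall k, S k -> g k <= 0) ->
  (forall k, ~~ S k -> \sum_l P k l * g l = g k) ->
  forall k, g k <= 0.
Proof.
move=> Sk0 gS gP.
have [m _ gm] := @arg_maxP _ _ _ k0 predT g isT.
suff gm0 : g m <= 0 by move=> k; apply: le_trans (gm k _) gm0.
rewrite leNgt; apply/negP => gp.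
have step k l : pgraph P k l -> g k = g m -> g l = g m.
  move=> kl gk.
  have Sk : ~~ S k by apply/negP => /gS; rewrite gk leNgt gp.
  have s0 : \sum_j P k j * (g m - g j) = 0.
    under eq_bigr do rewrite mulrBr.
    by rewrite sumrB -mulr_suml sP.2 mul1r gP// gk subrr.
  have nn j : 0 <= P k j * (g m - g j).
    by apply: mulr_ge0; [exact: sP.1|rewrite subr_ge0; exact: gm].
  have /eqP : P k l * (g m - g l) = 0.
    apply/eqP; rewrite eq_le nn andbT -s0 (bigD1 l)//= lerDl.
    by rewrite sumr_ge0.
  by rewrite mulf_eq0 gt_eqF//= subr_eq0 => /eqP.
have walk s i : path (pgraph P) i s -> g i = g m -> g (last i s) = g m.
  elim: s i => [|j s IH] i //= /andP[ij js] gi.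
  by apply: IH => //; exact: step gi.
have /connectP[s ps lk0] := cP m k0.
have := walk s m ps erefl.
by rewrite -lk0 => e; have := gS _ Sk0; rewrite e leNgt gp.
Qed.

Lemma WmxE z i j : Wmx P z i j = (1 - z 0 i) * P i j + z 0 i *+ (i == j).
Proof.
rewrite /Wmx mulmxBl mul1mx mul_diag_mx !mxE mulrBl mul1r; congr (_ + _).
Qed.

Lemma row_stochastic_Wmx z : (forall i, 0 <= z 0 i <= 1) -> row_stochastic (Wmx P z).
Proof.
move=> z01; split => [i j|i].
  have /andP[z0 z1] := z01 i.
  by rewrite WmxE addr_ge0 ?mulrn_wge0// mulr_ge0 ?subr_ge0//; exact: sP.1.
under eq_bigr do rewrite WmxE.
rewrite big_split/= -mulr_sumr sP.2 (bigD1 i)//= eqxx big1 ?addr0; last first.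
  by move=> j /negPf ji; rewrite eq_sym ji.
by rewrite mulr1 mulr1n subrK.
Qed.

Lemma mxpow_Wmx_absorbing z t i j : z 0 i = 1 ->
  mxpow (Wmx P z) t i j = (i == j)%:R.
Proof.
move=> zi; elim: t => [|t IH]; first by rewrite mxE.
rewrite mxpowS mxE (bigD1 i)//= big1 ?addr0 => [|k /negPf ki].
  by rewrite IH WmxE zi subrr mul0r add0r eqxx mul1r.
by rewrite WmxE zi subrr mul0r add0r eq_sym ki mul0r.
Qed.

Lemma Hmx_lim z i j (l : R) :
  (fun t => mxpow (Wmx P z) t i j) @ \oo --> l -> Hmx P z i j = l.
Proof. by move=> h; rewrite mxE; exact: cvg_lim. Qed.

Lemma Hmx_absorbing z i j : z 0 i = 1 -> Hmx P z i j = (i == j)%:R.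
Proof.
move=> zi; apply: Hmx_lim; under eq_fun do rewrite mxpow_Wmx_absorbing//.
exact: cvg_cst.
Qed.

(** * The limit matrix when some agent is fully stubborn: absorption probabilities *)

Section Stubborn.
Variables (z : 'rV[R]_n) (k0 : 'I_n).
Hypotheses (z01 : forall i, 0 <= z 0 i <= 1) (zk0 : z 0 k0 = 1).
Let S : pred 'I_n := fun k => z 0 k == 1.
Let W := Wmx P z.

Let sWt t : row_stochastic (mxpow W t).
Proof. exact/row_stochastic_mxpow/row_stochastic_Wmx. Qed.

(** Mass that has reached an absorbing [j] stays there, so the entry is nondecreasing in [t] and
    bounded by 1. *)
Let cvgS i j : S j -> (fun t => mxpow W t i j) @ \oo --> Hmx P z i j.
Proof.
move=> /eqP Sj; rewrite mxE.
apply: nondecreasing_is_cvgn.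
  apply/nondecreasing_seqP => t.
  rewrite mxpowSr mxE (bigD1 j)//= {2}/W WmxE Sj eqxx subrr mul0r add0r mulr1.
  rewrite lerDl sumr_ge0// => k _; rewrite mulr_ge0//; first exact: (sWt t).1.
  exact: (row_stochastic_Wmx z01).1.
exists 1 => _ [t _ <-]; rewrite -((sWt t).2 i) (bigD1 j)//= lerDl.
by rewrite sumr_ge0// => k _; exact: (sWt t).1.
Qed.

(** First-step analysis: the limit satisfies [H = W H], and row [i] of this relation can be divided
    by [1 - z 0 i], which is nonzero outside [S]. *)
Let harmonicS i j : ~~ S i -> S j -> \sum_k P i k * Hmx P z k j = Hmx P z i j.
Proof.
move=> Si Sj.
have e : Hmx P z i j = \sum_k W i k * Hmx P z k j.
  have c1 : (fun t => \sum_k W i k * mxpow W t k j) @ \oo --> \sum_k W i k * Hmx P z k j.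
    apply: (@cvg_sum_fin R _ predT (fun k t => W i k * mxpow W t k j)) => k _.
    by apply: cvgM; [exact: cvg_cst|exact: cvgS].
  have c2 : (fun t => \sum_k W i k * mxpow W t k j) @ \oo --> Hmx P z i j.
    have := @cvgS i j Sj; rewrite -(cvg_shiftS (fun t => mxpow W t i j))/=.
    by under eq_fun do rewrite mxE.
  by rewrite -(cvg_lim (@Rhausdorff R) c1) -(cvg_lim (@Rhausdorff R) c2).
have zi : 1 - z 0 i != 0 by rewrite subr_eq0 eq_sym.
have WH : \sum_k W i k * Hmx P z k j =
    (1 - z 0 i) * (\sum_k P i k * Hmx P z k j) + z 0 i * Hmx P z i j.
  under eq_bigr do rewrite /W WmxE mulrDl -mulrA.
  rewrite big_split/= -mulr_sumr; congr (_ + _).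
  rewrite (bigD1 i)//= eqxx big1 ?addr0//.
  by move=> k /negPf ki; rewrite eq_sym ki mulr0n mul0r.
apply: (mulfI zi); rewrite [RHS]mulrBl mul1r {1}e WH.
by rewrite addrK.
Qed.

(** Absorption is certain: the escaping mass [r] is nonnegative, zero on [S] and harmonic outside
    it, so the maximum principle kills it. *)
Let Hmx_S_sum i : \sum_(j | S j) Hmx P z i j = 1.
Proof.
pose r i := 1 - \sum_(j | S j) Hmx P z i j.
have cr k : (fun t => 1 - \sum_(j | S j) mxpow W t k j) @ \oo --> r k.
  apply: cvgB; first exact: cvg_cst.
  by apply: cvg_sum_fin => j; exact: cvgS.
have r0 k : 0 <= r k.
  apply: (seq_cvg_ge0 _ (cr k)) => t.
  rewrite subr_ge0 -((sWt t).2 k) [leRHS](bigID S)/= lerDl.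
  by rewrite sumr_ge0// => l _; exact: (sWt t).1.
have r1 : forall k, r k <= 0.
  apply: (@maximum_principle S r k0); first exact/eqP.
    move=> k Sk; rewrite /r (bigD1 k)//= Hmx_absorbing ?eqxx; last exact/eqP.
    rewrite big1 ?addr0 ?subrr// => j /andP[_ /negPf jk].
    by rewrite Hmx_absorbing; [rewrite eq_sym jk|exact/eqP].
  move=> k Sk; rewrite /r.
  under eq_bigr do rewrite mulrBr mulr1.
  rewrite sumrB sP.2; congr (_ - _).
  under eq_bigr do rewrite mulr_sumr.
  rewrite exchange_big/=; apply: eq_bigr => j Sj; exact: harmonicS.
by apply/eqP; rewrite -subr_eq0 -oppr_eq0 opprB; apply/eqP/le_anti; rewrite r0 r1.
Qed.

Lemma Hmx_stubborn_ge0 i j : z 0 j = 1 -> 0 <= Hmx P z i j.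
Proof.
move=> zj; apply: (seq_cvg_ge0 _ (@cvgS i j _)); last exact/eqP.
by move=> t; exact: (sWt t).1.
Qed.

(** The entry is squeezed between 0 and the mass not yet absorbed, which vanishes in the limit. *)
Lemma Hmx_stubborn_eq0 i j : z 0 j != 1 -> Hmx P z i j = 0.
Proof.
move=> zj; apply: Hmx_lim.
apply: (@squeeze_cvgr _ _ _ _ (fun=> 0) (fun t => 1 - \sum_(j | S j) mxpow W t i j)).
- near=> t; rewrite (sWt t).1/= -((sWt t).2 i) [X in X - _](bigID S)/= addrAC subrr add0r.
  rewrite (bigD1 j)//= lerDl sumr_ge0// => k _; exact: (sWt t).1.
- exact: cvg_cst.
- rewrite -[X in _ --> X](subrr 1) -[X in _ - X](Hmx_S_sum i).
  apply: cvgB; first exact: cvg_cst.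
  by apply: cvg_sum_fin => k; exact: cvgS.
Unshelve. all: by end_near. Qed.

Lemma Hmx_stubborn_sum i : \sum_j Hmx P z i j = 1.
Proof.
rewrite -[RHS](Hmx_S_sum i) (bigID S)/= [X in _ + X]big1 ?addr0//.
by move=> j; exact: Hmx_stubborn_eq0.
Qed.

Lemma Hmx_stubborn_harmonic i j : z 0 i != 1 ->
  \sum_k P i k * Hmx P z k j = Hmx P z i j.
Proof.
move=> zi; have [/eqP Sj|zj] := boolP (S j); first by apply: harmonicS; rewrite // /S Sj.
by rewrite Hmx_stubborn_eq0// big1// => k _; rewrite Hmx_stubborn_eq0 ?mulr0.
Qed.

End Stubborn.

(** [Hmx P z] solves a Dirichlet problem for [P] whose boundary is the set of fully stubborn agents;
    the values of [z] elsewhere do not enter it. Uniqueness is the maximum principle applied to both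
    differences. *)
Lemma Hmx_stubborn_ext z z' (k0 : 'I_n) :
  (forall i, 0 <= z 0 i <= 1) -> (forall i, 0 <= z' 0 i <= 1) ->
  z 0 k0 = 1 -> (forall k, (z 0 k == 1) = (z' 0 k == 1)) ->
  Hmx P z = Hmx P z'.
Proof.
move=> z01 z'01 zk0 zz'; apply/matrixP => i j.
have half (u u' : 'rV[R]_n) : (forall i, 0 <= u 0 i <= 1) -> (forall i, 0 <= u' 0 i <= 1) ->
    u 0 k0 = 1 -> (forall k, (u 0 k == 1) = (u' 0 k == 1)) ->
    Hmx P u i j <= Hmx P u' i j.
  move=> u01 u'01 uk0 uu'; rewrite -subr_le0.
  have u'k0 : u' 0 k0 = 1 by apply/eqP; rewrite -uu' uk0.
  apply: (@maximum_principle (fun k => u 0 k == 1)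
    (fun k => Hmx P u k j - Hmx P u' k j) k0); first exact/eqP.
    move=> k uk; rewrite !Hmx_absorbing ?subrr//; apply/eqP => //.
    by rewrite -uu'.
  move=> k uk; under eq_bigr do rewrite mulrBr.
  by rewrite sumrB !(@Hmx_stubborn_harmonic _ k0)// -uu'.
apply/le_anti/andP; split; apply: half => //.
by apply/eqP; rewrite -zz' zk0.
Qed.

End LimitMatrix.

(** * Best responses *)

Section BestResponse.
Variables (R : realType) (n : nat) (P : 'M[R]_n) (pi s2 : 'rV[R]_n).
Hypotheses (sP : row_stochastic P) (cP : strongly_connected P).
Hypotheses (aP : aperiodic P) (piP : stationary_prob P pi).
Hypothesis s2_gt0 : forall i, 0 < s2 0 i.
Implicit Types (z : 'rV[R]_n) (i j k : 'I_n).

Lemma setcE z i x j : setc z i x 0 j = if j == i then x else z 0 j.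
Proof. by rewrite mxE. Qed.

Lemma setc_itv z i x : (forall j, 0 <= z 0 j <= 1) -> 0 <= x <= 1 ->
  forall j, 0 <= setc z i x 0 j <= 1.
Proof. by move=> z01 x01 j; rewrite setcE; case: ifP. Qed.

(** [pi] is also stationary for a positive power of [P], and some entry of [pi] is positive. *)
Lemma stationary_gt0 i : 0 < pi 0 i.
Proof.
case: piP => pi0 [pi1 pE]; have [N PN] := mxpow_primitive sP cP aP.
have pN : pi *m mxpow P N = pi.
  by elim: {PN} N => [|N IH]; rewrite ?mulmx1// mxpowS mulmxA pE.
have [k pk] : exists k, 0 < pi 0 k.
  apply/not_existsP => np.
  have : \sum_i pi 0 i = 0.
    by apply: big1 => k _; apply/le_anti; rewrite pi0 andbT leNgt; apply/negP/np.
  by rewrite pi1 => /eqP; rewrite oner_eq0.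
rewrite -pN mxE (bigD1 k)//= ltr_pwDl ?mulr_gt0// sumr_ge0// => j _.
by rewrite mulr_ge0// ltW.
Qed.

(** Entrywise [W >= c P] with [c] the least [1 - z 0 k], hence [W ^ t >= c ^ t P ^ t]. *)
Lemma mxpow_Wmx_gt0 z N : (forall i, 0 <= z 0 i < 1) ->
  (forall i j, 0 < mxpow P N i j) -> forall i j, 0 < mxpow (Wmx P z) N i j.
Proof.
move=> z01 PN i j.
pose c := \big[Num.min/1]_k (1 - z 0 k).
have c0 : 0 < c by apply: lt_bigmin => // k _; rewrite subr_gt0; case/andP: (z01 k).
have cz k : c <= 1 - z 0 k by exact: bigmin_le.
have zle k : 0 <= z 0 k <= 1 by have /andP[-> /ltW->] := z01 k.
suff h t k l : c ^+ t * mxpow P t k l <= mxpow (Wmx P z) t k l.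
  by apply: lt_le_trans (h N i j); rewrite mulr_gt0// exprn_gt0.
elim: t k l => [|t IH] k l; first by rewrite mul1r.
rewrite !mxpowS !mxE mulr_sumr; apply: ler_sum => m _.
rewrite exprS mulrACA; apply: ler_pM.
- by rewrite mulr_ge0 ?(ltW c0)//; exact: sP.1.
- rewrite mulr_ge0 ?exprn_ge0 ?(ltW c0)//.
  exact: (row_stochastic_mxpow t sP).1.
- rewrite WmxE; apply: (@le_trans _ _ ((1 - z 0 k) * P k m)).
    by rewrite ler_wpM2r//; exact: sP.1.
  by rewrite lerDl mulrn_wge0//; case/andP: (z01 k).
- exact: IH.
Qed.

(** Weights [pi_k / (1 - z_k)] are stationary for [W(z)]: the factor [1 - z_k] cancels in the moving
    part, leaving [pi P = pi]. Since [W(z)] is primitive, its powers converge to this row. *)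
Lemma Hmx_interior z i j : (forall k, 0 <= z 0 k < 1) ->
  Hmx P z i j = pi 0 j / (1 - z 0 j) / \sum_k pi 0 k / (1 - z 0 k).
Proof.
move=> z01; have [N PN] := mxpow_primitive sP cP aP.
have v0 k : 0 < 1 - z 0 k by rewrite subr_gt0; case/andP: (z01 k).
have a0 k : 0 < pi 0 k / (1 - z 0 k) by rewrite divr_gt0// stationary_gt0.
pose c := \sum_k pi 0 k / (1 - z 0 k).
have c0 : 0 < c.
  by rewrite /c (bigD1 i)//= ltr_pwDl// sumr_ge0// => k _; exact: ltW.
pose h : 'rV[R]_n := \row_k (pi 0 k / (1 - z 0 k) / c).
have zle k : 0 <= z 0 k <= 1 by have /andP[-> /ltW->] := z01 k.
have -> : pi 0 j / (1 - z 0 j) / c = h 0 j by rewrite mxE.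
apply: Hmx_lim; apply: (@mxpow_cvg_stationary R n _ N h).
- exact: row_stochastic_Wmx.
- exact: mxpow_Wmx_gt0.
- by move=> k; rewrite mxE ltW// divr_gt0.
- by under eq_bigr do rewrite mxE; rewrite -mulr_suml divff// gt_eqF.
- apply/rowP => l; rewrite mxE.
  under eq_bigr do rewrite WmxE mulrDr.
  rewrite big_split/= [X in _ + X](bigD1 l)//= eqxx [X in _ + (_ + X)]big1 ?addr0; last first.
    by move=> k /negPf kl; rewrite kl mulr0.
  have -> : \sum_k h 0 k * ((1 - z 0 k) * P k l) = pi 0 l / c.
    have <- : (pi *m P) 0 l = pi 0 l by case: piP => _ [_ ->].
    rewrite mxE mulr_suml; apply: eq_bigr => k _; rewrite mxE.
    by field; rewrite !gt_eqF.
  by rewrite !mxE mulr1n; field; rewrite !gt_eqF.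
Qed.

(** This is the [m_i] of the overview: the value of [potential z i] at [z 0 i = 0], and so its
    minimum over [0 <= z 0 i < 1]. *)
Definition bound i : R := pi 0 i * s2 0 i.

Definition potential z i : R := bound i / (1 - z 0 i).

Definition others_avg (y : 'I_n -> R) i : R :=
  (\sum_(j | j != i) y j ^+ 2 / s2 0 j) / (\sum_(j | j != i) y j / s2 0 j).

Lemma bound_gt0 i : 0 < bound i.
Proof. by rewrite mulr_gt0// stationary_gt0. Qed.

Lemma cost_absorbing z i : z 0 i = 1 -> cost P s2 i z = s2 0 i.
Proof.
move=> zi; rewrite /cost (bigD1 i)//= Hmx_absorbing// eqxx expr1n mul1r.
rewrite big1 ?addr0// => j /negPf ji.
by rewrite Hmx_absorbing// eq_sym ji expr0n mul0r.
Qed.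

(** Completing the square in the cost, a ratio of quadratics in [1 - x]. The square vanishes where
    the potential of [i] equals [G]. The formula also covers [x = 1], where the row of [i] is a unit
    vector and the cost is [s2 0 i]. *)
Lemma cost_interior z i (A G : R) x :
  (forall j, j != i -> 0 <= z 0 j < 1) ->
  A = \sum_(j | j != i) potential z j / s2 0 j -> 0 < A ->
  G = others_avg (potential z) i ->
  0 < G -> 0 <= x <= 1 ->
  cost P s2 i (setc z i x) = s2 0 i * (G / (G + s2 0 i * A) +
    s2 0 i * A / (G + s2 0 i * A) *
    ((bound i - G * (1 - x)) / (bound i + s2 0 i * A * (1 - x))) ^+ 2).
Proof.
move=> z01 AE A0 GE G0 /andP[x0 x1].
have b0 := bound_gt0 i; have si := s2_gt0 i.
have B0 : 0 < s2 0 i * A by rewrite mulr_gt0.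
have [->|xn1] := eqVneq x 1.
  rewrite cost_absorbing ?setcE ?eqxx// subrr !mulr0 subr0 addr0 divff ?gt_eqF//.
  by field; rewrite gt_eqF// addr_gt0.
have {xn1}x1 : x < 1 by rewrite lt_neqAle xn1.
have v0 : 0 < 1 - x by rewrite subr_gt0.
have C : \sum_(j | j != i) potential z j ^+ 2 / s2 0 j = G * A.
  by rewrite GE AE /others_avg -AE divfK// gt_eqF.
have s01 k : 0 <= setc z i x 0 k < 1.
  by rewrite setcE; case: ifPn => [_|/z01//]; rewrite x0.
have pE j : j != i -> pi 0 j / (1 - setc z i x 0 j) = potential z j / s2 0 j.
  move=> ji; rewrite setcE (negPf ji) /potential /bound.
  by field; rewrite gt_eqF//= gt_eqF// subr_gt0; case/andP: (z01 _ ji).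
have sumE : \sum_k pi 0 k / (1 - setc z i x 0 k) = pi 0 i / (1 - x) + A.
  rewrite (bigD1 i)//= setcE eqxx; congr (_ + _).
  by rewrite AE; apply: eq_bigr => j; exact: pE.
rewrite /cost; under eq_bigr do rewrite Hmx_interior// sumE.
rewrite (bigD1 i)//= setcE eqxx.
have -> : \sum_(j | j != i) (pi 0 j / (1 - setc z i x 0 j) / (pi 0 i / (1 - x) + A)) ^+ 2
    * s2 0 j = G * A / (pi 0 i / (1 - x) + A) ^+ 2.
  rewrite -C mulr_suml; apply: eq_bigr => j ji; rewrite pE//.
  have p0 := stationary_gt0 i; field.
  by rewrite !gt_eqF// ?addr_gt0// ?mulr_gt0.
rewrite /bound; have p0 := stationary_gt0 i.
field.
by rewrite !gt_eqF// ?addr_gt0// ?mulr_gt0// ?addr_gt0// ?mulr_gt0.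
Qed.

(** Only [rho ^+ 2] depends on [x]. If [b <= G], its unique zero [1 - b / G] lies in the unit
    interval; otherwise [rho 0] is positive and is exceeded at every other point, so the minimum is
    at 0. The [max] merges the two cases. *)
Lemma best_resp_interior z i : (exists k, k != i) ->
  (forall j, j != i -> 0 <= z 0 j < 1) ->
  best_resp P s2 i z =
    [set 1 - bound i / Num.max (bound i) (others_avg (potential z) i)].
Proof.
move=> [k ki] z01.
have y0 j : j != i -> 0 < potential z j.
  by move=> /z01/andP[_ zj]; rewrite divr_gt0 ?bound_gt0// subr_gt0.
pose A := \sum_(j | j != i) potential z j / s2 0 j.
have A0 : 0 < A.
  rewrite /A (bigD1 k)//=; apply: ltr_pwDl; first by rewrite divr_gt0// y0.
  by apply: sumr_ge0 => j /andP[/y0 yj _]; rewrite divr_ge0// ltW.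
pose G := others_avg (potential z) i.
have G0 : 0 < G.
  apply: divr_gt0 => //; rewrite (bigD1 k)//=; apply: ltr_pwDl.
    by rewrite divr_gt0// exprn_gt0// y0.
  by apply: sumr_ge0 => j /andP[/y0 yj _]; rewrite divr_ge0 ?exprn_ge0// ltW.
have b0 := bound_gt0 i; have si := s2_gt0 i.
have costE := cost_interior z01 (erefl A) A0 (erefl G) G0.
rewrite -/G; set b := bound i in b0 costE *.
set B := s2 0 i * A in costE.
have B0 : 0 < B by rewrite mulr_gt0.
pose rho x := (b - G * (1 - x)) / (b + B * (1 - x)).
have den x : x <= 1 -> 0 < b + B * (1 - x).
  by move=> x1; rewrite ltr_pwDl// mulr_ge0 ?subr_ge0// ltW.
have cost_le x y : 0 <= x <= 1 -> 0 <= y <= 1 ->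
    (cost P s2 i (setc z i x) <= cost P s2 i (setc z i y)) = (rho x ^+ 2 <= rho y ^+ 2).
  move=> x01 y01; rewrite !costE// ler_pM2l// lerD2l ler_pM2l//.
  by rewrite divr_gt0// addr_gt0.
pose xs := 1 - b / Num.max b G.
have m0 : 0 < Num.max b G by rewrite lt_max b0.
have xs01 : 0 <= xs <= 1.
  rewrite subr_ge0 gerBl ler_pdivrMr// mul1r le_max lexx/=.
  by rewrite divr_ge0// ltW.
have rho_xs y : 0 <= y <= 1 -> y != xs -> rho xs ^+ 2 < rho y ^+ 2.
  move=> /andP[yge0 y1] yxs; have dy := den _ y1.
  have [bG|Gb] := leP b G.
    have xsE : xs = 1 - b / G by rewrite /xs; congr (_ - _ / _); exact/max_idPr.
    have -> : rho xs = 0.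
      by rewrite /rho xsE subKr [G * _]mulrC divfK ?subrr ?mul0r// gt_eqF.
    rewrite expr0n exprn_even_gt0//= mulf_neq0 ?invr_eq0 ?(gt_eqF dy)//.
    apply: contra yxs => /eqP e; rewrite xsE; apply/eqP.
    have -> : b = G * (1 - y) by apply/eqP; rewrite -subr_eq0 e.
    by field; rewrite gt_eqF.
  have xsE : xs = 0.
    have -> : xs = 1 - b / b by rewrite /xs; congr (_ - _ / _); apply/max_idPl/ltW.
    by rewrite divff ?subrr// gt_eqF.
  have yp : 0 < y by rewrite lt_neqAle yge0 eq_sym -xsE yxs.
  have dx : 0 < b + B by rewrite addr_gt0.
  rewrite xsE; have r0 : 0 < rho 0.
    by rewrite /rho !subr0 !mulr1 divr_gt0// subr_gt0.
  have ry : rho 0 < rho y.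
    rewrite /rho !subr0 !mulr1 ltr_pdivrMr// mulrAC ltr_pdivlMr//.
    have BG : 0 < B + G by exact: addr_gt0.
    (* This product is exactly the difference of the two cross-multiplied sides. *)
    have : 0 < b * (B + G) * y by apply: mulr_gt0 => //; exact: mulr_gt0.
    nra.
  by rewrite ltr_pXn2r// nnegrE ltW// (lt_trans r0).
apply/seteqP; split => [x [x01 xmin]|_ ->] /=.
  apply: contrapT => /eqP xxs; have := xmin _ xs01.
  by rewrite cost_le// leNgt rho_xs.
split=> // y y01; rewrite cost_le//.
have [->//|yxs] := eqVneq y xs; exact/ltW/rho_xs.
Qed.

Lemma br_step_interior z i u : (exists k, k != i) ->
  (forall j, j != i -> 0 <= z 0 j < 1) ->
  br_step P s2 z i u =
    setc z i (1 - bound i / Num.max (bound i) (others_avg (potential z) i)).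
Proof.
move=> ki z01; rewrite /br_step best_resp_interior// sup1 inf1 subrr mulr0 addr0.
by [].
Qed.

(** On [x < 1] the set of stubborn agents is fixed, so the cost is a constant [c]. At [x = 1] it is
    [s2 0 i], and [c <= s2 0 i] because the row of [H] is a probability carried by agents of no
    larger variance. The best-response set thus contains all of [[0, 1[], and its uniform draw is
    [u]. *)
Lemma br_step_stubborn z i k u : (forall j, 0 <= z 0 j <= 1) -> k != i ->
  z 0 k = 1 -> (forall j, j != i -> z 0 j = 1 -> s2 0 j <= s2 0 i) ->
  br_step P s2 z i u = setc z i u.
Proof.
move=> z01 ki zk smax.
pose c := cost P s2 i (setc z i 0).
have c01 x : 0 <= x < 1 -> forall j, 0 <= setc z i x 0 j <= 1.
  by move=> /andP[x0 x1]; apply: setc_itv; rewrite // x0 ltW.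
have z0k x : setc z i x 0 k = 1 by rewrite setcE (negPf ki).
have i01 : 0 <= (0 : R) < 1 by rewrite lexx ltr01.
have cE x : 0 <= x < 1 -> cost P s2 i (setc z i x) = c.
  move=> x01; rewrite /c /cost.
  rewrite (@Hmx_stubborn_ext _ _ _ sP cP (setc z i x) (setc z i 0) k)//; try exact: c01.
  move=> l; rewrite !setcE; case: ifP => // _.
  by rewrite lt_eqF ?lt_eqF// ?ltr01//; case/andP: x01.
have cle : c <= s2 0 i.
  have e := @Hmx_stubborn_sum _ _ _ sP cP _ k (c01 _ i01) (z0k _) i.
  rewrite -[leRHS]mul1r -e mulr_suml; apply: ler_sum => j _.
  have [zj|zj] := eqVneq (setc z i 0 0 j) 1; last first.
    by rewrite (@Hmx_stubborn_eq0 _ _ _ sP cP _ k)// ?expr0n ?mul0r//; exact: c01.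
  have H0 l : 0 <= Hmx P (setc z i 0) i l.
    have [zl|zl] := eqVneq (setc z i 0 0 l) 1.
      by apply: Hmx_stubborn_ge0 => //; exact: c01.
    by rewrite (@Hmx_stubborn_eq0 _ _ _ sP cP _ k)//; exact: c01.
  have H1 : Hmx P (setc z i 0) i j <= 1.
    by rewrite -e (bigD1 j)//= lerDl sumr_ge0.
  have sj : s2 0 j <= s2 0 i.
    have [->//|ji] := eqVneq j i; apply: smax => //.
    by move: zj; rewrite setcE (negPf ji).
  apply: ler_pM => //; [exact: sqr_ge0|exact: ltW|].
  by rewrite expr2 -[leRHS]mulr1 ler_wpM2l.
have Bsub x : 0 <= x < 1 -> best_resp P s2 i z x.
  move=> x01; have /andP[x0 x1] := x01; split; first by rewrite x0 ltW.
  move=> y /andP[y0]; rewrite le_eqVlt => /orP[/eqP ->|y1].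
    by rewrite (cE x)// cost_absorbing// setcE eqxx.
  by rewrite !cE// y0.
have Bub : ubound (best_resp P s2 i z) 1 by move=> x [/andP[]].
have Blb : lbound (best_resp P s2 i z) 0 by move=> x [/andP[]].
have Bne : best_resp P s2 i z !=set0 by exists 0; exact: Bsub.
have infB : inf (best_resp P s2 i z) = 0.
  apply/le_anti; rewrite lb_le_inf// andbT; apply: ge_inf; first by exists 0.
  exact: Bsub.
have supB : sup (best_resp P s2 i z) = 1.
  apply/le_anti; rewrite ge_sup//=; apply/ler_addgt0Pr => e e0.
  have [e1|e1] := ltP e 1; last first.
    rewrite (le_trans e1)// lerDr; apply: ub_le_sup; first by exists 1.
    exact: Bsub.
  rewrite -lerBlDr; apply: ub_le_sup; first by exists 1.
  by apply: Bsub; rewrite subr_ge0 (ltW e1) ltrBlDr ltrDl.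
by rewrite /br_step infB supB subr0 mulr1 add0r.
Qed.

Lemma br_step_itv z i u : (forall j, 0 <= z 0 j <= 1) -> 0 <= u <= 1 ->
  forall j, 0 <= br_step P s2 z i u 0 j <= 1.
Proof.
move=> z01 u01; apply: setc_itv => //.
set B := best_resp P s2 i z.
(* [inf] and [sup] of the empty set are both 0, so the draw would be 0. *)
have [->|/set0P[x Bx]] := eqVneq B set0.
  by rewrite inf0 sup0 subrr mulr0 addr0 lexx ler01.
have Bub : ubound B 1 by move=> y [/andP[]].
have Blb : lbound B 0 by move=> y [/andP[]].
have Bne : B !=set0 by exists x.
have i0 : 0 <= inf B by exact: lb_le_inf.
have s1 : sup B <= 1 by exact: ge_sup.
have is1 : inf B <= sup B.
  apply: (@le_trans _ _ x); first by apply: ge_inf => //; exists 0.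
  by apply: ub_le_sup => //; exists 1.
by move: u01 => /andP[u0 u1]; apply/andP; split; nra.
Qed.

End BestResponse.

(** * Averaging dynamics *)

Section Averaging.
Variables (R : realType) (n : nat) (pi s2 : 'rV[R]_n).
Hypothesis s2_gt0 : forall i, 0 < s2 0 i.
Implicit Types (y : 'I_n -> R) (i j k : 'I_n).

Let m := bound pi s2.

(** A best response in potential coordinates; the [max] with [m i] is the constraint
    [0 <= z 0 i]. *)
Definition revise y i : 'I_n -> R :=
  fun j => if j == i then Num.max (m i) (others_avg s2 y i) else y j.

Lemma others_weight_gt0 y i : (exists k, k != i) -> (forall j, 0 < y j) ->
  0 < \sum_(j | j != i) y j / s2 0 j.
Proof.
move=> [k ki] y0; rewrite (bigD1 k)//=; apply: ltr_pwDl; first exact: divr_gt0.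
by apply: sumr_ge0 => j _; rewrite divr_ge0 ?ltW.
Qed.

Lemma others_avgB y i c : (exists k, k != i) -> (forall j, 0 < y j) ->
  others_avg s2 y i - c = (\sum_(j | j != i) y j / s2 0 j * (y j - c)) /
                          (\sum_(j | j != i) y j / s2 0 j).
Proof.
move=> ki y0; have A0 := others_weight_gt0 ki y0.
rewrite /others_avg; set A := \sum_(j | j != i) y j / s2 0 j in A0 *.
have -> : \sum_(j | j != i) y j / s2 0 j * (y j - c) =
    \sum_(j | j != i) y j ^+ 2 / s2 0 j - A * c.
  rewrite /A mulr_suml -sumrB; apply: eq_bigr => j _.
  by field; rewrite gt_eqF.
by field; rewrite gt_eqF.
Qed.

Lemma others_avg_itv y i lo hi : (exists k, k != i) -> (forall j, 0 < y j) ->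
  (forall j, lo <= y j <= hi) -> lo <= others_avg s2 y i <= hi.
Proof.
move=> ki y0 yb; have A0 := others_weight_gt0 ki y0.
rewrite -subr_ge0 -[_ <= hi]subr_le0 !others_avgB//; apply/andP; split.
  rewrite divr_ge0 ?(ltW A0)// sumr_ge0// => j _.
  by rewrite mulr_ge0 ?divr_ge0 ?(ltW (y0 _)) ?(ltW (s2_gt0 _))// subr_ge0; case/andP: (yb j).
rewrite -oppr_ge0 -mulNr divr_ge0 ?(ltW A0)// -sumrN sumr_ge0// => j _.
rewrite -mulrN mulr_ge0 ?divr_ge0 ?(ltW (y0 _)) ?(ltW (s2_gt0 _))//.
by rewrite opprB subr_ge0; case/andP: (yb j).
Qed.

(** If [j] holds a share at least [d] of the weight, its excess over [lo] enters the average with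
    factor at least [d], and the other excesses are nonnegative. *)
Lemma others_avg_lb y i j lo d : j != i -> (forall k, 0 < y k) ->
  (forall k, lo <= y k) -> d * (\sum_(k | k != i) y k / s2 0 k) <= y j / s2 0 j ->
  d * (y j - lo) <= others_avg s2 y i - lo.
Proof.
move=> ji y0 ylo dj; have ki : exists k, k != i by exists j.
have A0 := others_weight_gt0 ki y0.
rewrite others_avgB// ler_pdivlMr// [leRHS](bigD1 j)//= mulrAC.
apply: (@le_trans _ _ (y j / s2 0 j * (y j - lo))).
  by rewrite ler_wpM2r// subr_ge0.
rewrite lerDl sumr_ge0// => k _.
by rewrite mulr_ge0 ?divr_ge0 ?(ltW (y0 _)) ?(ltW (s2_gt0 _))// subr_ge0.
Qed.

(** Supplies a share [d] valid for all configurations with values between [lo] and [hi]: smallest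
    possible weight over largest possible total. *)
Lemma others_weight_lb lo hi : (0 < n)%N -> 0 < lo -> lo <= hi ->
  exists d : R, [/\ 0 < d, d <= 1 & forall y, (forall k, lo <= y k <= hi) ->
    forall i j, j != i -> d * (\sum_(k | k != i) y k / s2 0 k) <= y j / s2 0 j].
Proof.
move=> n0 lo0 lohi; have hi0 := lt_le_trans lo0 lohi.
pose B := \sum_k hi / s2 0 k.
have B0 : 0 < B.
  rewrite /B (bigD1 (Ordinal n0))//=; apply: ltr_pwDl; first exact: divr_gt0.
  by apply: sumr_ge0 => j _; rewrite divr_ge0 ?ltW.
exists (\big[Num.min/1]_k (lo / s2 0 k / B)); split.
- by apply: lt_bigmin => // k _; rewrite !divr_gt0.
- exact: bigmin_le_id.
move=> y yb i j ji.
have yw k : y k / s2 0 k <= hi / s2 0 k.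
  by rewrite ler_pM2r ?invr_gt0//; case/andP: (yb k).
apply: (@le_trans _ _ (lo / s2 0 j / B * B)); last first.
  by rewrite divfK ?gt_eqF// ler_pM2r ?invr_gt0//; case/andP: (yb j).
apply: ler_pM.
- by apply: le_bigmin => // k _; rewrite !divr_ge0// ?ltW.
- apply: sumr_ge0 => k _; rewrite divr_ge0 ?(ltW (s2_gt0 _))//.
  by rewrite (le_trans (ltW lo0))//; case/andP: (yb k).
- exact: bigmin_le.
- apply: (@le_trans _ _ (\sum_(k | k != i) hi / s2 0 k)).
    by apply: ler_sum => k _; exact: yw.
  by rewrite /B [leRHS](bigD1 i)//= lerDr divr_ge0 ?ltW.
Qed.

(** An average stays in the interval, and the clamp cannot leave it either, since
    [m i <= y i <= hi]. *)
Lemma revise_itv y i lo hi : (exists k, k != i) -> (forall j, 0 < y j) ->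
  (forall j, m j <= y j) ->
  (forall j, lo <= y j <= hi) -> forall j, lo <= revise y i j <= hi.
Proof.
move=> ki y0 ym yb j; rewrite /revise; case: ifP => // _.
have /andP[h1 h2] := others_avg_itv ki y0 yb.
by rewrite le_max h1 orbT ge_max h2 andbT (le_trans (ym i))//; case/andP: (yb i).
Qed.

Lemma revise_ge_bound y i : (forall j, m j <= y j) -> forall j, m j <= revise y i j.
Proof.
move=> ym j; rewrite /revise; case: eqP => // ->.
by rewrite le_max lexx.
Qed.

(** * Contraction of the range along a run of revisions *)

Section Run.
Variables (y : nat -> 'I_n -> R) (a : nat -> 'I_n).
Hypotheses (n1 : (1 < n)%N) (m0 : forall j, 0 < m j).
Hypotheses (ym : forall j, m j <= y 0%N j) (yS : forall t, y t.+1 = revise (y t) (a t)).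

Lemma other_agent i : exists k : 'I_n, k != i.
Proof.
have n0 : (0 < n)%N by exact: ltn_trans n1.
have [->|h] := eqVneq i (Ordinal n0); last by exists (Ordinal n0); rewrite eq_sym.
by exists (Ordinal n1).
Qed.

Lemma run_ge_bound t j : m j <= y t j.
Proof. by elim: t j => // t IH j; rewrite yS; exact: revise_ge_bound. Qed.

Lemma run_gt0 t j : 0 < y t j.
Proof. exact: lt_le_trans (m0 j) (run_ge_bound t j). Qed.

Lemma run_itv t s lo hi : (forall j, lo <= y t j <= hi) ->
  forall j, lo <= y (t + s)%N j <= hi.
Proof.
move=> yb; elim: s => [|s IH]; first by rewrite addn0.
rewrite addnS yS; apply: revise_itv => //; first exact: other_agent.
  exact: run_gt0.
exact: run_ge_bound.
Qed.

(* If the first agent of the sweep ends up well above the minimum, she pulls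
   everybody else up; otherwise everybody else was already near the minimum. *)
Lemma sweep_contraction t (w : seq 'I_n) d lo hi i0 :
  uniq w -> (forall j, j \in w) ->
  (forall r, (r < size w)%N -> a (t + r)%N = nth i0 w r) ->
  0 < d -> d <= 1 ->
  (forall r i j, j != i -> d * (\sum_(k | k != i) y r k / s2 0 k) <= y r j / s2 0 j) ->
  (forall j, lo <= y t j <= hi) ->
  osc (y (t + size w)%N) <= (1 - d ^+ 2 / 2) * (hi - lo).
Proof.
move=> wu wall aw d0 d1 dP yb.
have lohi : lo <= hi by have /andP[/le_trans] := yb i0; apply.
have w0 : (0 < size w)%N by case: w wall {wu aw} => // /(_ i0).
pose f := nth i0 w 0%N.
have af : a t = f by rewrite -[t]addn0 aw.
have c0 : 0 <= (1 - d ^+ 2 / 2) * (hi - lo).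
  rewrite mulr_ge0 ?subr_ge0//; nra.
have yrb r := run_itv r yb.
have ylo r j : lo <= y (t + r)%N j by case/andP: (yrb r j).
have yhi r j : y (t + r)%N j <= hi by case/andP: (yrb r j).
have yfE : y t.+1 f = Num.max (m f) (others_avg s2 (y t) f).
  by rewrite yS af /revise eqxx.
have [high|low] := leP (lo + d / 2 * (hi - lo)) (y t.+1 f).
  (* The word has no repetition, so [f] revises only at the first step of the sweep. *)
  have stay r : (0 < r <= size w)%N -> y (t + r)%N f = y t.+1 f.
    elim: r => // r IH /andP[_ rw]; have [->|r0] := posnP r; first by rewrite addn1.
    rewrite addnS yS /revise ifF; first by rewrite IH// r0 ltnW.
    by rewrite aw// /f nth_uniq// ltn_eqF.
  (* Each later agent sees [f] with share at least [d], so it rises to at least [d * (d / 2)] of the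
     range above [lo], and does not move again during the sweep. *)
  have up r : (0 < r <= size w)%N -> forall j, j \in take r w ->
      lo + d ^+ 2 / 2 * (hi - lo) <= y (t + r)%N j.
    elim: r => // r IH /andP[_ rw] j.
    rewrite (take_nth i0)// mem_rcons inE => /orP[/eqP jE|jr]; last first.
      have r0 : (0 < r)%N by case: r jr {IH rw}; rewrite ?take0.
      rewrite addnS yS /revise ifF; first by apply: IH => //; rewrite r0 ltnW.
      apply/negbTE/eqP => jE; move: jr; rewrite jE aw//.
      by rewrite in_take ?mem_nth// index_uniq// ltnn.
    have [r0|r0] := posnP r.
      move: jE; rewrite r0 -/f => ->; rewrite addn1.
      apply: le_trans high; rewrite lerD2l ler_wpM2r ?subr_ge0//; nra.
    have jf : f != j by rewrite jE /f nth_uniq// eq_sym -lt0n.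
    have := others_avg_lb jf (run_gt0 _) (ylo r) (dP _ _ _ jf).
    have rr : (0 < r <= size w)%N by rewrite r0 ltnW.
    rewrite (stay r rr) => h.
    rewrite addnS yS /revise aw// -jE eqxx le_max; apply/orP; right.
    have h' : d * (d / 2 * (hi - lo)) <= d * (y t.+1 f - lo).
      by rewrite ler_pM2l// lerBrDl.
    rewrite -lerBrDl; apply: le_trans h; apply: le_trans h'.
    by rewrite expr2 !mulrA.
  apply: osc_le => // i j.
  have := up (size w); rewrite leqnn w0 take_size => /(_ isT j (wall j)).
  have := yhi (size w) i; lra.
(* Here the average seen by [f] is less than [d / 2] of the range above [lo]; each other agent holds
   a share at least [d] of it, hence is at most half the range above [lo]. *)
have near j : j != f -> y t j <= lo + (hi - lo) / 2.
  move=> jf; have ylo0 k : lo <= y t k by have := ylo 0%N k; rewrite addn0.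
  have := others_avg_lb jf (run_gt0 _) ylo0 (dP _ _ _ jf).
  have : others_avg s2 (y t) f <= y t.+1 f by rewrite yfE le_max lexx orbT.
  move=> h1 h2; have : d * (y t j - lo) <= d * ((hi - lo) / 2).
    by apply: (le_trans h2); lra.
  by rewrite ler_pM2l//; lra.
have b1 j : lo <= y t.+1 j <= lo + (hi - lo) / 2.
  have := ylo 1%N j; rewrite addn1 => -> /=.
  have [->|jf] := eqVneq j f; first by apply: (le_trans (ltW low)); nra.
  by rewrite yS /revise af (negPf jf) near.
apply: osc_le => // i j.
have := run_itv (size w).-1 b1; rewrite addSnnS prednK// => yb'.
have /andP[_ hi'] := yb' i; have /andP[lo' _] := yb' j.
(* The range has halved after one step and cannot grow again; [d <= 1] gives
   [1 / 2 <= 1 - d ^+ 2 / 2]. *)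
apply: (@le_trans _ _ ((hi - lo) / 2)); first by lra.
by rewrite mulrC ler_wpM2r ?subr_ge0//; nra.
Qed.

Lemma run_itv_osc t : exists lo hi,
  (forall j, lo <= y t j <= hi) /\ hi - lo <= osc (y t).
Proof.
have n0 : (0 < n)%N by exact: ltn_trans n1.
have [p _ hp] := @arg_maxP _ _ _ (Ordinal n0) predT (y t) isT.
have [q _ hq] := @arg_minP _ _ _ (Ordinal n0) predT (y t) isT.
exists (y t q), (y t p); split; last exact: osc_ge.
by move=> j; apply/andP; split; [exact: hq|exact: hp].
Qed.

(** The whole run stays between the least [m j] and the initial maximum, so one share [d] serves for
    all times: every occurrence of [w] contracts by the same factor, and no step increases the
    range. *)
Lemma run_osc_cvg0 (w : seq 'I_n) i0 : uniq w -> (forall j, j \in w) ->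
  (forall t0, exists2 t, (t0 <= t)%N &
    forall r, (r < size w)%N -> a (t + r)%N = nth i0 w r) ->
  (fun t => osc (y t)) @ \oo --> 0.
Proof.
move=> wu wall io.
have n0 : (0 < n)%N by exact: ltn_trans n1.
have [lo [hi [yb _]]] := run_itv_osc 0.
pose b := \big[Num.min/m i0]_j m j.
have b0 : 0 < b by apply: lt_bigmin.
have yb' t j : b <= y t j <= hi.
  have := run_itv t yb j; rewrite add0n => /andP[_ ->]; rewrite andbT.
  by rewrite (le_trans _ (run_ge_bound t j))// bigmin_le.
have bhi : b <= hi by have /andP[/le_trans] := yb' 0%N i0; apply.
have [d [d0 d1 dP]] := others_weight_lb n0 b0 bhi.
apply: (@contracting_cvg0 _ _ (1 - d ^+ 2 / 2) (size w)).
- by move=> t; exact: osc_ge0.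
- move=> t.
  have [lo' [hi' [ybt le]]] := run_itv_osc t.
  apply: le_trans le; apply: osc_le => [|i j].
    by rewrite subr_ge0; have /andP[/le_trans] := ybt i0; apply.
  have := run_itv 1 ybt; rewrite addn1 => h.
  have /andP[_ ?] := h i; have /andP[? _] := h j; lra.
- nra.
- by rewrite ltrBlDr ltrDl divr_gt0// exprn_gt0.
- move=> t0; have [t tt0 aw] := io t0; exists t => //.
  have [lo' [hi' [ybt le]]] := run_itv_osc t.
  apply: le_trans (sweep_contraction wu wall aw d0 d1 _ ybt) _.
    by move=> r i j ji; exact: dP.
  by rewrite ler_wpM2l//; nra.
Qed.

End Run.
End Averaging.

(** * Trajectories *)

Section Trajectory.
Variables (R : realType) (n : nat) (P : 'M[R]_n) (pi s2 : 'rV[R]_n).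
Hypotheses (sP : row_stochastic P) (cP : strongly_connected P).
Hypotheses (aP : aperiodic P) (piP : stationary_prob P pi).
Hypothesis s2_gt0 : forall i, 0 < s2 0 i.
Implicit Types (z : 'rV[R]_n) (i j k : 'I_n).

Let m := bound pi s2.
Let m_gt0 := bound_gt0 sP cP aP piP s2_gt0.

(** The comparison point of [Zstar] has [alpha = c^-1], admissible because [c] dominates every
    [m i]; [Num.sqrt n%:R] passes from the sup norm to the Euclidean one. *)
Lemma dist_set_Zstar_le z c e : (0 < n)%N -> 0 <= e -> 0 < c ->
  (forall i, m i <= c) -> (forall i, `|z 0 i - (1 - m i / c)| <= e) ->
  0 <= dist_set z (Zstar pi s2) <= Num.sqrt n%:R * e.
Proof.
move=> n0 e0 c0 mc ze.
pose w : 'rV[R]_n := \row_i (1 - c^-1 * pi 0 i * s2 0 i).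
have Zw : Zstar pi s2 w.
  exists c^-1; split=> //; rewrite invr_gt0 c0/= /alpha_star div1r.
  rewrite lef_pV2 ?posrE//.
    by apply: bigmax_le => [|i _]; [exact: ltW|exact: mc].
  exact: lt_le_trans (m_gt0 (Ordinal n0)) (le_bigmax _ _ _).
have lb : lbound [set Defs.edist z w | w in Zstar pi s2] 0.
  by move=> _ [v _ <-]; exact: sqrtr_ge0.
apply/andP; split; first by apply: lb_le_inf => //; exists (Defs.edist z w), w.
apply: (@le_trans _ _ (Defs.edist z w)).
  by apply: ge_inf; [exists 0|exists w].
rewrite /Defs.edist -[e]ger0_norm// -sqrtr_sqr -sqrtrM// ler_sqrt ?mulr_ge0 ?sqr_ge0//.
have -> : n%:R * e ^+ 2 = \sum_(i < n) e ^+ 2.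
  by rewrite sumr_const card_ord mulr_natl.
apply: ler_sum => i _; rewrite -[leLHS]real_normK ?num_real//.
rewrite lerXn2r ?nnegrE// mxE; move: (ze i); rewrite /m /bound.
by rewrite [pi 0 i * s2 0 i / c]mulrC mulrA.
Qed.

Lemma traj_itv z0 K U : (forall i, 0 <= z0 0 i <= 1) -> (forall t, 0 <= U t < 1) ->
  forall t i, 0 <= traj P s2 z0 K U t 0 i <= 1.
Proof.
move=> z01 U01; elim=> //= t IH; apply: br_step_itv => //.
by have /andP[-> /ltW->] := U01 t.
Qed.

Lemma interior_response_itv z i u : (exists k, k != i) ->
  (forall j, j != i -> 0 <= z 0 j < 1) -> 0 <= br_step P s2 z i u 0 i < 1.
Proof.
move=> ki z01; rewrite (br_step_interior sP cP aP piP)// setcE eqxx.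
set M := Num.max _ _.
have M0 : 0 < M by rewrite lt_max m_gt0.
rewrite subr_ge0 ler_pdivrMr// mul1r le_max lexx/= ltrBlDr ltrDl.
by rewrite divr_gt0// m_gt0.
Qed.

(* Revising in order of decreasing variance, each agent in turn only faces
   stubborn agents of smaller variance, hence prefers to listen to them. *)
Lemma traj_sweep_lt1 z0 K U t (w : seq 'I_n) i0 : (1 < n)%N ->
  (forall i, 0 <= z0 0 i <= 1) -> (forall t, 0 <= U t < 1) ->
  uniq w -> (forall j, j \in w) -> sorted (fun i j => s2 0 j <= s2 0 i) w ->
  (forall r, (r < size w)%N -> K (t + r)%N = nth i0 w r) ->
  forall i, 0 <= traj P s2 z0 K U (t + size w) 0 i < 1.
Proof.
move=> n1 z01 U01 wu wall wsort Kw.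
have Zitv := traj_itv K z01 U01.
suff h r : (r <= size w)%N -> forall i, i \in take r w -> traj P s2 z0 K U (t + r) 0 i < 1.
  by move=> i; rewrite h ?take_size// andbT; case/andP: (Zitv (t + size w)%N i).
elim: r => [_ i|r IH rw i]; first by rewrite take0.
have {}IH := IH (ltnW rw).
rewrite addnS /= Kw//; set z := traj _ _ _ _ _ _ in IH *; set f := nth i0 w r.
have zitv j : 0 <= z 0 j <= 1 by exact: Zitv.
rewrite (take_nth i0)// -/f mem_rcons inE.
have [-> _|ne] /= := eqVneq i f; last first.
  by move=> /IH zi; rewrite /br_step setcE (negPf ne).
(* Facing a stubborn agent, [f] draws [u < 1]; facing none, her unique best response is below 1. *)
have [[k [kf zk]]|nk] := pselect (exists k, k != f /\ z 0 k = 1).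
  rewrite (@br_step_stubborn _ _ _ _ sP cP s2_gt0 _ _ k)//.
    by rewrite setcE eqxx; case/andP: (U01 (t + r)%N).
  move=> j jf zj.
  (* Agents already revised are below 1, so a stubborn [j] comes later in [w] and has no larger
     variance. *)
  have : j \notin take r w by apply/negP => /IH; rewrite zj ltxx.
  rewrite in_take// -leqNgt leq_eqVlt => /orP[/eqP re|rj].
    by move: jf; rewrite /f re nth_index ?eqxx.
  rewrite -(nth_index i0 (wall j)) /f.
  apply: (@sorted_ltn_nth _ (fun i j => s2 0 j <= s2 0 i)) => //.
    by move=> x u v /= h1 h2; exact: le_trans h2 h1.
  by rewrite inE index_mem.
have lt1 j : j != f -> 0 <= z 0 j < 1.
  move=> jf; have /andP[-> zj1] := zitv j; rewrite lt_neqAle zj1 andbT.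
  by apply/negP => /eqP zj; apply: nk; exists j.
by have /andP[] := interior_response_itv (U (t + r)%N) (other_agent n1 f) lt1.
Qed.

(** Transfers the dynamics to the averaging run: [z_i = 1 - m_i / M] means [y_i = M]. *)
Lemma potential_br_step z i u : (exists k, k != i) -> (forall j, 0 <= z 0 j < 1) ->
  potential pi s2 (br_step P s2 z i u) = revise pi s2 (potential pi s2 z) i.
Proof.
move=> ki z01; apply/funext => j; rewrite /revise {1}/potential.
rewrite (br_step_interior sP cP aP piP)// setcE; case: eqP => [->|//].
rewrite subKr; set M := Num.max _ _.
have M0 : 0 < M by rewrite lt_max m_gt0.
by field; rewrite !gt_eqF// m_gt0.
Qed.

Lemma potential_ge_bound z i : (forall j, 0 <= z 0 j < 1) -> m i <= potential pi s2 z i.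
Proof.
move=> /(_ i)/andP[zi0 zi1].
rewrite /potential ler_pdivlMr ?subr_gt0// -[leRHS]mulr1 ler_pM2l ?m_gt0//.
by rewrite gerBl.
Qed.

Lemma traj_cvg_Zstar z0 K U (w : seq 'I_n) i0 : (1 < n)%N ->
  (forall i, 0 <= z0 0 i <= 1) -> (forall t, 0 <= U t < 1) ->
  uniq w -> (forall j, j \in w) -> sorted (fun i j => s2 0 j <= s2 0 i) w ->
  (forall t0, exists2 t, (t0 <= t)%N &
    forall r, (r < size w)%N -> K (t + r)%N = nth i0 w r) ->
  (fun t => dist_set (traj P s2 z0 K U t) (Zstar pi s2)) @ \oo --> 0.
Proof.
move=> n1 z01 U01 wu wall wsort io.
have [t1 _ Kt1] := io 0%N.
(* End of the first occurrence of the word; from then on nobody is stubborn. *)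
pose T := (t1 + size w)%N.
have lt1 t i : 0 <= traj P s2 z0 K U (t + T) 0 i < 1.
  elim: t i => [|t IH] i; first by rewrite add0n; exact: traj_sweep_lt1 Kt1 _.
  rewrite addSn /=; have [->|ne] := eqVneq i (K (t + T)%N).
    by apply: interior_response_itv => //; exact: other_agent.
  by rewrite /br_step setcE (negPf ne).
pose y t := potential pi s2 (traj P s2 z0 K U (t + T)).
have ym j : m j <= y 0%N j by apply: potential_ge_bound; exact: lt1.
have yS t : y t.+1 = revise pi s2 (y t) (K (t + T)%N).
  by rewrite /y addSn /= potential_br_step//; exact: other_agent.
have ocvg : (fun t => osc (y t)) @ \oo --> 0.
  apply: (run_osc_cvg0 s2_gt0 n1 m_gt0 ym yS wu wall (i0 := i0)) => t0.
  have [t tt0 Kt] := io (t0 + T)%N.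
  have Tt : (T <= t)%N := leq_trans (leq_addl _ _) tt0.
  exists (t - T)%N; first by rewrite leq_subRL 1?addnC.
  by move=> r rw; rewrite addnAC subnK// Kt.
pose b := \big[Num.min/m i0]_j m j.
have b0 : 0 < b by apply: lt_bigmin => [|j _]; exact: m_gt0.
rewrite -(cvg_shiftn T).
apply: (@squeeze_cvgr _ _ _ _ (fun=> 0) (fun t => Num.sqrt n%:R * (b^-1 * osc (y t)))).
- near=> t; have n0 : (0 < n)%N by exact: ltn_trans n1.
  have [p _ hp] := @arg_maxP _ _ _ (Ordinal n0) predT (y t) isT.
  have my j : m j <= y t j by apply: potential_ge_bound; exact: lt1.
  have y0 j : 0 < y t j := lt_le_trans (m_gt0 j) (my j).
  apply: (@dist_set_Zstar_le _ (y t p)) => //.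
  + by rewrite mulr_ge0 ?osc_ge0// invr_ge0 ltW.
  + by move=> i; apply: le_trans (my i) _; exact: hp.
  + move=> i; have v0 : 0 < 1 - traj P s2 z0 K U (t + T) 0 i.
      by rewrite subr_gt0; case/andP: (lt1 t i).
    have -> : traj P s2 z0 K U (t + T) 0 i = 1 - m i / y t i.
      have mi : m i != 0 by rewrite gt_eqF// m_gt0.
      by rewrite /y /potential -/m invf_div mulrCA divff// mulr1 subKr.
    (* With [c] the current maximum [y t p], the error factors as [m i / y t i <= 1], times
       [c^-1 <= b^-1], times a difference bounded by the oscillation. *)
    have -> : 1 - m i / y t i - (1 - m i / y t p) =
        - (m i / y t i * ((y t p)^-1 * (y t p - y t i))).
      by field; rewrite !gt_eqF.
    have hpi : 0 <= y t p - y t i by rewrite subr_ge0; exact: hp.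
    have h1 : 0 <= m i / y t i.
      by apply: divr_ge0; apply: ltW; [exact: m_gt0|exact: y0].
    have h2 : 0 <= (y t p)^-1 * (y t p - y t i) by rewrite mulr_ge0// invr_ge0 ltW.
    rewrite normrN ger0_norm; last exact: mulr_ge0.
    rewrite -[leRHS]mul1r; apply: ler_pM => //.
    * by rewrite ler_pdivrMr// mul1r.
    * apply: ler_pM => //; [by rewrite invr_ge0 ltW| |exact: osc_ge].
      rewrite lef_pV2 ?posrE//; apply: le_trans (my p).
      exact: bigmin_le.
- exact: cvg_cst.
- rewrite -(mulr0 (Num.sqrt n%:R)); apply: cvgM; first exact: cvg_cst.
  by rewrite -(mulr0 b^-1); apply: cvgM => //; exact: cvg_cst.
Unshelve. all: by end_near. Qed.

(** With a single agent [Zstar] is [[0, 1[], so every point of the unit interval, 1 included, is at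
    distance 0 from it. *)
Lemma traj_dist_single z0 K U t : n = 1%N ->
  (forall i, 0 <= z0 0 i <= 1) -> (forall t, 0 <= U t < 1) ->
  dist_set (traj P s2 z0 K U t) (Zstar pi s2) = 0.
Proof.
move=> n1 z01 U01; have n0 : (0 < n)%N by rewrite n1.
have zitv := traj_itv K z01 U01 t; set z := traj _ _ _ _ _ _ in zitv *.
pose i0 := Ordinal n0.
have i0E i : i = i0 by apply/val_inj => /=; move: (ltn_ord i); rewrite {2}n1; case: (nat_of_ord i).
have /andP[zge zle] := zitv i0.
have key e : 0 < e -> e <= 1 -> 0 <= dist_set z (Zstar pi s2) <= e.
  move=> e0 e1; have mi := m_gt0 i0.
  (* A point of [[0, 1[] within [e] of [z]. *)
  pose x := Num.min (z 0 i0) (1 - e).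
  have x1 : x < 1 by rewrite gt_min; apply/orP; right; lra.
  have x0 : 0 <= x by rewrite le_min zge subr_ge0.
  have v0 : 0 < 1 - x by rewrite subr_gt0.
  have sq : Num.sqrt n%:R * e = e by rewrite n1 sqrtr1 mul1r.
  rewrite -sq; apply: (@dist_set_Zstar_le z (m i0 / (1 - x)) e) => //.
  - exact: ltW.
  - by rewrite divr_gt0.
  - move=> i; rewrite (i0E i) ler_pdivlMr// -[leRHS]mulr1 ler_pM2l// gerBl//.
  - move=> i; rewrite (i0E i).
    have -> : 1 - m i0 / (m i0 / (1 - x)) = x by field; rewrite !gt_eqF.
    rewrite /x; have [h|h] := leP (z 0 i0) (1 - e); first by rewrite subrr normr0 ltW.
    by rewrite ger0_norm; lra.
apply/le_anti; have /andP[-> _] := key 1 ltr01 (lexx _); rewrite andbT.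
apply/ler_addgt0Pr => e e0; rewrite add0r.
have [e1|/ltW e1] := leP e 1; first by case/andP: (key e e0 e1).
by have /andP[_ /le_trans] := key 1 ltr01 (lexx _); apply.
Qed.

End Trajectory.

(** * The driving noise *)

Section Noise.
Variables (d : measure_display) (T : measurableType d) (R : realType).
Variables (Pr : probability T R) (n : nat) (Z0 : 'I_n -> T -> R).
Variables (K : nat -> T -> 'I_n) (U : nat -> T -> R).
Hypotheses (n0 : (0 < n)%N) (noise : driving_noise Pr Z0 K U).

Let K_measurable t k : measurable (K t @^-1` [set k]).
Proof. by case: noise. Qed.

Let U_measurable t : measurable_fun setT (U t).
Proof. by case: noise. Qed.

Let pr (X : set T) : R := fine (Pr X).

Let prK X : measurable X -> (pr X)%:E = Pr X.
Proof. by move=> mX; rewrite fineK// fin_num_measure. Qed.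

Lemma noise_cylinder (s : seq nat) (A : nat -> {set 'I_n}) (C : nat -> set R) :
  uniq s -> (forall t, measurable (C t)) ->
  fine (Pr (\bigcap_(t in [set t | t \in s])
              (K t @^-1` [set k | k \in A t] `&` U t @^-1` C t))) =
  \prod_(t <- s) (#|A t|%:R / n%:R *
                  fine (lebesgue_measure (C t `&` `[0, 1]%classic))).
Proof.
move=> us mC; case: noise => _ _ _ /(_ s (fun=> setT) A C us (fun=> measurableT) mC).
have -> : \bigcap_(i in [set: 'I_n]) (Z0 i @^-1` setT) = setT.
  by apply/seteqP; split.
by rewrite setTI probability_setT /= mul1r.
Qed.

(** The endpoint 1 must be excluded too, for an indifferent agent who draws it would remain
    stubborn; within [[0, 1]] it is a Lebesgue-null point. *)
Lemma noise_unit_interval t : Pr (U t @^-1` (~` `[0, 1[%classic)) = 0%E.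
Proof.
have mC : measurable (~` `[0, 1[%classic : set R) by exact: measurableC.
have := @noise_cylinder [:: t] (fun=> [set: 'I_n]%SET) (fun=> ~` `[0, 1[%classic) isT (fun=> mC).
rewrite big_seq1.
have -> : (~` `[0, 1[ `&` `[0, 1])%classic = [set 1 : R].
  apply/seteqP; split => [x|x ->] /=; rewrite !in_itv/=.
    move=> [h /andP[x0 x1]]; apply/le_anti; rewrite x1 leNgt.
    by apply/negP => xl; apply: h; rewrite x0.
  by rewrite ltxx ler01 lexx; split => //; rewrite andbF.
rewrite lebesgue_measure_set1 /= mulr0 => e.
have mX : measurable (U t @^-1` (~` `[0, 1[%classic)).
  by rewrite -[X in measurable X]setTI; exact: U_measurable.
rewrite -[LHS]prK//; congr _%:E; rewrite -[RHS]e /pr; congr (fine (Pr _)).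
apply/seteqP; split => [w Uw s /=|w /(_ t)/=]; rewrite inE.
  by move=> /eqP ->; split => //=; rewrite inE.
by rewrite eqxx => /(_ isT) [].
Qed.

(** * Almost sure recurrence of a finite word of agents *)

Section Word.
Variables (w : seq 'I_n) (i0 : 'I_n).
Hypothesis w0 : (0 < size w)%N.
Let L := size w.
Let q : R := n%:R^-1.

(** Times are matched against the periodic repetition of [w], so [hit (block j)] says that [w] is
    read from time [j * L] on; distinct blocks use disjoint times. *)
Let hit (s : seq nat) : set T :=
  \bigcap_(t in [set t | t \in s]) K t @^-1` [set nth i0 w (t %% L)].

Let block j := iota (j * L) L.

Let measurable_hit s : measurable (hit s).
Proof. by apply: bigcap_measurableType => t _; exact: K_measurable. Qed.

Let pr_hit s : uniq s -> pr (hit s) = q ^+ size s.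
Proof.
move=> us.
have := @noise_cylinder s (fun t => [set nth i0 w (t %% L)]%SET) (fun=> setT) us
  (fun=> measurableT).
have -> : \prod_(t <- s) (#|[set nth i0 w (t %% L)]%SET|%:R / n%:R *
    fine (lebesgue_measure (setT `&` `[0, 1]%classic : set R))) = q ^+ size s.
  have -> : fine (lebesgue_measure (setT `&` `[0, 1]%classic : set R)) = 1.
    by rewrite setTI lebesgue_measure_itv/= lte_fin ltr01 sube0.
  under eq_bigr do rewrite cards1 div1r mulr1.
  by elim: (s) => [|t s' IH]; rewrite ?big_nil// big_cons IH exprS.
move=> <-; congr (fine (Pr _)); apply: eq_bigcapr => t _.
by rewrite preimage_setT setIT; apply/seteqP; split => v /=; rewrite inE => /eqP.
Qed.

Let missed N m : set T := \bigcap_(j in [set j | (j < m)%N]) ~` hit (block (N + j)).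

Let measurable_missed N m : measurable (missed N m).
Proof. by apply: bigcap_measurableType => j _; exact: measurableC. Qed.

Let missedS N m : missed N m.+1 = missed N m `\` hit (block (N + m)).
Proof.
apply/seteqP; split => [v h|v [h1 h2] j /=].
  by split=> [j jm|]; apply: h => //=; exact: ltnW.
by rewrite ltnS leq_eqVlt => /orP[/eqP ->//|]; exact: h1.
Qed.

Let hit_cat s s' : hit (s ++ s') = hit s `&` hit s'.
Proof.
apply/seteqP; split => [v h|v [h1 h2] t /=].
  by split=> t /= ts; apply: h; rewrite /= mem_cat ts ?orbT.
by rewrite mem_cat => /orP[]; [exact: h1|exact: h2].
Qed.

(* Carrying an extra future cylinder through the induction avoids the
   independence of complements. *)
Let pr_missed N m s : uniq s -> {in s, forall t, (((N + m) * L) <= t)%N} ->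
  pr (hit s `&` missed N m) = q ^+ size s * (1 - q ^+ L) ^+ m.
Proof.
elim: m s => [|m IH] s us sN.
  rewrite mulr1 -pr_hit// (_ : missed N 0 = setT) ?setIT//.
  by apply/seteqP; split.
(* The next block is removed by subtraction; the subtracted event is [hit (s ++ block (N + m))] with
   [m] blocks missed, so the induction hypothesis covers both terms. *)
rewrite missedS setIDA /pr measureD//; last 2 first.
- exact: measurableI.
- by rewrite -ge0_fin_numE ?fin_num_measure//; exact: measurableI.
have mX : measurable (hit s `&` missed N m) by exact: measurableI.
rewrite fineB; try by apply: fin_num_measure => //; exact: measurableI.
rewrite -setIA (setIC (missed N m)) setIA -hit_cat -!/(pr _).
have bl t : t \in block (N + m) -> ((N + m) * L <= t < (N + m.+1) * L)%N.
  by rewrite mem_iota addnS mulSn [(L + _)%N]addnC.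
rewrite IH//; last first.
  by move=> t /sN; apply: leq_trans; rewrite leq_mul2r leq_add2l leqnSn orbT.
rewrite IH.
- by rewrite size_cat size_iota exprD [in RHS]exprSr; ring.
- rewrite cat_uniq us iota_uniq andbT /=; apply/hasPn => t /bl /andP[_ tl].
  by apply/negP => /sN; rewrite leqNgt tl.
- move=> t; rewrite mem_cat => /orP[/sN|/bl/andP[]//].
  by apply: leq_trans; rewrite leq_mul2r leq_add2l leqnSn orbT.
Qed.

(** The probability is at most [(1 - q ^+ L) ^+ m] for every [m]. *)
Let missed_forever N : Pr (\bigcap_j ~` hit (block (N + j))) = 0%E.
Proof.
have mX : measurable (\bigcap_j ~` hit (block (N + j))).
  by apply: bigcap_measurableType => j _; exact: measurableC.
rewrite -prK//; congr _%:E; apply/le_anti/andP; split; last exact: fine_ge0.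
have qn : 0 < q by rewrite invr_gt0 ltr0n.
have q1 : q <= 1 by rewrite invf_le1 ?ltr0n// ler1n.
have qL : 0 < q ^+ L by rewrite exprn_gt0.
have qL1 : q ^+ L <= 1 by rewrite exprn_ile1// ltW.
have le m : pr (\bigcap_j ~` hit (block (N + j))) <= (1 - q ^+ L) ^+ m.
  have := @pr_missed N m [::] isT; rewrite expr0 mul1r => <-//.
  rewrite fine_le ?fin_num_measure//; try exact: measurableI.
  apply: le_measure; rewrite ?inE//; first exact: measurableI.
  by move=> v h; split=> j //= _; exact: h.
have c : (fun m => (1 - q ^+ L) ^+ m) @ \oo --> 0.
  by apply: cvg_expr; rewrite ger0_norm ?subr_ge0// ltrBlDr ltrDl.
rewrite -(cvg_lim (@Rhausdorff R) c); apply: limr_ge.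
  by apply/cvg_ex; exists 0.
by exists 0%N => // m _; exact: le.
Qed.

Lemma noise_word_infinitely_often : exists E : set T, [/\ measurable E, Pr E = 1%E &
  forall v, E v -> (forall t, 0 <= U t v < 1) /\
    forall t0, exists2 t, (t0 <= t)%N &
      forall r, (r < size w)%N -> K (t + r)%N v = nth i0 w r].
Proof.
pose F1 t := U t @^-1` (~` `[0, 1[%classic).
pose F2 N := \bigcap_j ~` hit (block (N + j)).
(* A countable union of null events; letting [N] range over all starting blocks turns one occurrence
   into infinitely many. *)
pose F := (\bigcup_t F1 t) `|` (\bigcup_N F2 N).
have mF1 t : measurable (F1 t).
  rewrite /F1 -[X in measurable X]setTI; apply: U_measurable => //.
  exact: measurableC.
have mF2 N : measurable (F2 N).
  by apply: bigcap_measurableType => j _; exact: measurableC.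
have mF : measurable F by apply: measurableU; apply: bigcup_measurable.
have F0 : Pr F = 0%E.
  apply/negligibleP => //; apply: negligibleU; apply: negligible_bigcup => k.
    by apply/negligibleP => //; exact: noise_unit_interval.
  by apply/negligibleP => //; exact: missed_forever.
exists (~` F); split; first exact: measurableC.
  by rewrite probability_setC// F0 sube0.
move=> v nF; split => [t|t0].
  by apply: contrapT => h; apply: nF; left; exists t.
have [j hj] : exists j, hit (block (t0 + j)) v.
  apply: contrapT => h; apply: nF; right; exists t0 => // j _ /= hv.
  by apply: h; exists j.
exists ((t0 + j) * L)%N.
  by apply: (@leq_trans (t0 + j)); [exact: leq_addr|rewrite leq_pmulr].
move=> r rL; have /= := hj ((t0 + j) * L + r)%N.
by rewrite mem_iota leq_addr ltn_add2l rL modnMDl modn_small//; apply.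
Qed.

End Word.
End Noise.

Unset Implicit Arguments.

Theorem theorem3 (R : realType) (n : nat) (P : 'M[R]_n) (pi s2 : 'rV[R]_n)
  (d : measure_display) (T : measurableType d) (Pr : probability T R)
  (Z0 : 'I_n -> T -> R) (K : nat -> T -> 'I_n) (U : nat -> T -> R) :
  (0 < n)%N ->
  row_stochastic P -> strongly_connected P -> aperiodic P ->
  stationary_prob P pi ->
  (forall i, 0 < s2 0 i) ->
  (forall w i, 0 <= Z0 i w <= 1) ->
  driving_noise Pr Z0 K U ->
  exists E : set T, [/\ measurable E, Pr E = 1%E &
    forall w, E w ->
      (fun t : nat =>
         dist_set (traj P s2 (\row_i Z0 i w) (fun t => K t w) (fun t => U t w) t)
                  (Zstar pi s2)) @ \oo --> 0].
Proof.
move=> n0 sP cP aP piP s2_gt0 Z01 noise.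
pose i0 := Ordinal n0.
pose ge2 i j := s2 0 j <= s2 0 i.
pose word := sort ge2 (enum 'I_n).
have word_all j : j \in word by rewrite mem_sort mem_enum.
have word_uniq : uniq word by rewrite sort_uniq enum_uniq.
have word_sorted : sorted ge2 word.
  by apply: sort_sorted => i j; exact: le_total.
have word_gt0 : (0 < size word)%N by case: word word_all {word_uniq word_sorted} => // /(_ i0).
have [E [mE PE hE]] := noise_word_infinitely_often n0 noise i0 word_gt0.
exists E; split => // v /hE [U01 io].
have z01 i : 0 <= (\row_i Z0 i v) 0 i <= 1 by rewrite mxE.
(* A lone agent has nobody to average over, so [n = 1] is treated apart. *)
have [n1|n1] := leqP n 1.
  have {}n1 : n = 1%N by apply/eqP; rewrite eqn_leq n1.
  under eq_fun do rewrite (traj_dist_single sP cP aP piP s2_gt0)//.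
  exact: cvg_cst.
exact: (traj_cvg_Zstar sP cP aP piP s2_gt0 n1 z01 U01 word_uniq word_all word_sorted io).
Qed.
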